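(* The double well potential problem $\min_{w\in\mathbb{R}^n} g(w)$ has at most one local, but non-global, minimizer; that is, there is at most one point $\underline{w}\in\mathbb{R}^n$ that is a local minimizer of $g$ but not a global minimizer of $g$.
   Context: Let $n\ge 1$ be an integer, $\nu\in\mathbb{R}$, $\psi=(\psi_1,\dots,\psi_n)^T\in\mathbb{R}^n$, and $D=\mathrm{Diag}(\alpha_1,\dots,\alpha_n)$ a real diagonal matrix with $\alpha_1\le\alpha_2\le\dots\le\alpha_n$. The double well potential function is $g:\mathbb{R}^n\to\mathbb{R}$, $$g(w)=\frac12\left(\frac12\|w\|^2-\nu\right)^2+\frac12 w^TDw-\psi^Tw,$$ where $\|\cdot\|$ is the Euclidean norm. *)

(* Defs.v *)
From mathcomp Require Import all_boot all_order all_algebra.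
From mathcomp Require Import all_classical all_reals all_analysis.
Import Order.TTheory GRing.Theory Num.Theory.
Import numFieldNormedType.Exports.

Set Implicit Arguments.
Unset Strict Implicit.
Unset Printing Implicit Defensive.

Local Open Scope classical_set_scope.
Local Open Scope ring_scope.

(* The norm [`|w|] that the library puts on matrices is the sup norm, hence a
   separate definition of the Euclidean norm. *)
Definition enorm (R : realType) (n : nat) (w : 'cV[R]_n) : R :=
  Num.sqrt (\sum_(i < n) w i 0 ^+ 2).

(* The products [w^T *m D *m w] and [psi^T *m w] are 1 x 1 matrices; [_ 0 0]
   reads off their single entry. *)
Definition double_well (R : realType) (n : nat) (nu : R) (psi : 'cV[R]_n)
    (D : 'M[R]_n) (w : 'cV[R]_n) : R :=
  2^-1 * (2^-1 * enorm w ^+ 2 - nu) ^+ 2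
  + 2^-1 * (w^T *m D *m w) 0 0
  - (psi^T *m w) 0 0.

(* Local minimality refers to the topology of ['cV[R]_n]; it is the product
   topology, i.e. the one induced by [enorm]. *)
Definition local_minimizer (R : realType) (n : nat) (f : 'cV[R]_n -> R)
    (w : 'cV[R]_n) : Prop :=
  \forall v \near w, f w <= f v.

Definition global_minimizer (R : realType) (n : nat) (f : 'cV[R]_n -> R)
    (w : 'cV[R]_n) : Prop :=
  forall v : 'cV[R]_n, f w <= f v.

Definition local_nonglobal_minimizer (R : realType) (n : nat)
    (f : 'cV[R]_n -> R) (w : 'cV[R]_n) : Prop :=
  local_minimizer f w /\ ~ global_minimizer f w.

(* Main.v *)
(* At a local minimizer [w], put [a i = alpha i + (|w|^2 / 2 - nu)] and
   [A = diag a].  Then [A w = psi] and [A + w w^T] is positive semidefinite, so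
   [A] has at most one negative direction, and it has exactly one when [w] is
   not global; in that case [w^T A^-1 w <= -1], which says that the secular
   function [|(D + t I)^-1 psi|^2 - 2 (t + nu)] is nondecreasing at its zero
   [t = |w|^2 / 2 - nu].  That function is strictly convex on the relevant
   interval of [t], so it has at most one such zero.  Hence two local
   non-global minimizers [x] and [y] have equal norms; convexity enters as the
   coordinatewise bound
   [y_i^2 - x_i^2 >= - (|y|^2 - |x|^2) x_i^2 / a_i], summed over [i]. *)
Require Import Defs.
From mathcomp Require Import all_boot all_order all_algebra.
From mathcomp Require Import all_classical all_reals all_analysis.
From mathcomp Require Import ring lra.
Import Order.TTheory GRing.Theory Num.Theory.
Import numFieldNormedType.Exports.

Set Implicit Arguments.
Unset Strict Implicit.
Unset Printing Implicit Defensive.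

Local Open Scope ring_scope.

(** * Expansion along lines *)

Definition dot (R : realType) (n : nat) (u v : 'cV[R]_n) : R :=
  \sum_i u i 0 * v i 0.

(* The [i]-th diagonal entry of [A] in the Hessian [A + w w^T] of the double
   well at [w]. *)
Definition curv (R : realType) (n : nat) (nu : R) (alpha : 'rV[R]_n)
    (w : 'cV[R]_n) (i : 'I_n) : R :=
  alpha 0 i + (2^-1 * dot w w - nu).

Lemma double_wellE (R : realType) (n : nat) (nu : R) (psi : 'cV[R]_n)
    (alpha : 'rV[R]_n) (w : 'cV[R]_n) :
  double_well nu psi (diag_mx alpha) w =
  2^-1 * (2^-1 * dot w w - nu) ^+ 2
  + 2^-1 * (\sum_i alpha 0 i * w i 0 ^+ 2) - dot psi w.
Proof.
rewrite /double_well /enorm sqr_sqrtr; last first.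
  by apply: sumr_ge0 => i _; exact: sqr_ge0.
congr (_ * (_ * _ - _) ^+ 2 + _ * _ - _).
- by rewrite mul_mx_diag mxE; apply: eq_bigr => i _; rewrite !mxE; ring.
- by rewrite mxE; apply: eq_bigr => i _; rewrite mxE.
Qed.

(** The double well has degree 4, so its Taylor expansion along a line is exact. The coefficients of
    [s] and [s ^+ 2 / 2] exhibit the gradient [A w - psi] and the Hessian [A + w w^T]. *)
Lemma double_well_line (R : realType) (n : nat) (nu : R) (psi : 'cV[R]_n)
    (alpha : 'rV[R]_n) (w v : 'cV[R]_n) (s : R) :
  let a := curv nu alpha w in
  double_well nu psi (diag_mx alpha) (w + s *: v) =
  double_well nu psi (diag_mx alpha) w
  + s * (\sum_i (a i * w i 0 - psi i 0) * v i 0)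
  + s ^+ 2 / 2 * (\sum_i a i * v i 0 ^+ 2 + dot w v ^+ 2)
  + s ^+ 3 / 2 * (dot w v * dot v v) + s ^+ 4 / 8 * dot v v ^+ 2.
Proof.
move=> a; rewrite !double_wellE; pose q := 2^-1 * dot w w - nu.
have -> : dot (w + s *: v) (w + s *: v)
    = dot w w + 2 * s * dot w v + s ^+ 2 * dot v v.
  rewrite /dot !mulr_sumr -!big_split /=.
  by apply: eq_bigr => i _; rewrite !mxE; ring.
have -> : dot psi (w + s *: v) = dot psi w + s * dot psi v.
  rewrite /dot mulr_sumr -big_split /=.
  by apply: eq_bigr => i _; rewrite !mxE; ring.
have -> : \sum_i alpha 0 i * (w + s *: v) i 0 ^+ 2
    = \sum_i alpha 0 i * w i 0 ^+ 2
      + 2 * s * (\sum_i alpha 0 i * w i 0 * v i 0)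
      + s ^+ 2 * (\sum_i alpha 0 i * v i 0 ^+ 2).
  rewrite !mulr_sumr -!big_split /=.
  by apply: eq_bigr => i _; rewrite !mxE; ring.
have -> : \sum_i (a i * w i 0 - psi i 0) * v i 0
    = \sum_i alpha 0 i * w i 0 * v i 0
      + q * dot w v + -1 * dot psi v.
  rewrite /dot !mulr_sumr -!big_split /=.
  by apply: eq_bigr => i _; rewrite /a /curv -/q; ring.
have -> : \sum_i a i * v i 0 ^+ 2
    = \sum_i alpha 0 i * v i 0 ^+ 2 + q * dot v v.
  rewrite /dot !mulr_sumr -!big_split /=.
  by apply: eq_bigr => i _; rewrite /a /curv -/q; ring.
by rewrite /q; field.
Qed.

(** Serves to derive the optimality conditions: the increment along a line, divided by [s] or by
    [s ^+ 2 / 2], is a polynomial in [s], and its sign for small [s > 0] passes to its constant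
    coefficient. *)
Lemma horner_ge0_at_right (R : realType) (p : {poly R}) (x : R) :
  (\forall s \near at_right x, 0 <= p.[s]) -> 0 <= p.[x].
Proof.
move=> p_ge0; apply: (cvgr_to_ge _ p_ge0).
by apply: cvg_at_right_filter; exact: continuous_horner.
Qed.

(** * Necessary conditions at local and at non-global minimizers *)

Section SecondOrder.
Variables (R : realType) (n : nat) (nu : R) (psi : 'cV[R]_n) (alpha : 'rV[R]_n).
Let f := double_well nu psi (diag_mx alpha).
Variable w : 'cV[R]_n.
Let a := curv nu alpha w.

Lemma local_minimizer_line (v : 'cV[R]_n) :
  local_minimizer f w -> \forall s \near at_right (0 : R), f w <= f (w + s *: v).
Proof.
apply: (cvg_at_right_filter (f := fun s => w + s *: v)).
have := cvgD (cvg_cst w) (@scalel_continuous _ _ v 0).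
rewrite scale0r addr0; exact.
Qed.

Lemma local_minimizer_stationary :
  local_minimizer f w -> forall i, a i * w i 0 = psi i 0.
Proof.
move=> wmin.
have slope_ge0 (v : 'cV[R]_n) : 0 <= \sum_i (a i * w i 0 - psi i 0) * v i 0.
  set c := (X in 0 <= X).
  pose p := Poly [:: c; (\sum_i a i * v i 0 ^+ 2 + dot w v ^+ 2) / 2;
                     dot w v * dot v v / 2; dot v v ^+ 2 / 8].
  have -> : c = p.[0] by rewrite horner_Poly /=; ring.
  apply: horner_ge0_at_right.
  near=> s.
  have s_gt0 : 0 < s by near: s; exact: nbhs_right_gt.
  rewrite -(pmulr_rge0 _ s_gt0).
  have : f w <= f (w + s *: v) by near: s; exact: local_minimizer_line.
  rewrite /f double_well_line -/c -/a -subr_ge0 horner_Poly /=.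
  by congr (0 <= _); field.
have : 0 <= - \sum_i (a i * w i 0 - psi i 0) ^+ 2.
  (* Along minus the gradient, the slope is minus the squared length of the gradient. *)
  have := slope_ge0 (\col_i (psi i 0 - a i * w i 0)).
  congr (0 <= _); rewrite -sumrN; apply: eq_bigr => i _; rewrite mxE; ring.
rewrite oppr_ge0 => sq_le0 i; apply/eqP; rewrite -subr_eq0 -sqrf_eq0.
have sq_eq0 : \sum_i (a i * w i 0 - psi i 0) ^+ 2 = 0.
  by apply/eqP; rewrite eq_le sq_le0 sumr_ge0 // => j _; exact: sqr_ge0.
by rewrite (psumr_eq0P _ sq_eq0) // => j _; exact: sqr_ge0.
Unshelve. all: by end_near.
Qed.

Lemma local_minimizer_hessian_ge0 : local_minimizer f w ->
  forall v : 'cV[R]_n, 0 <= \sum_i a i * v i 0 ^+ 2 + dot w v ^+ 2.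
Proof.
move=> wmin v; set c := (X in 0 <= X).
have stat := local_minimizer_stationary wmin.
pose p := Poly [:: c; dot w v * dot v v; dot v v ^+ 2 / 4].
have -> : c = p.[0] by rewrite horner_Poly /=; ring.
apply: horner_ge0_at_right.
near=> s.
have s_gt0 : 0 < s by near: s; exact: nbhs_right_gt.
rewrite -(@pmulr_rge0 _ (s ^+ 2 / 2)); last by rewrite divr_gt0 ?exprn_gt0.
have : f w <= f (w + s *: v) by near: s; exact: local_minimizer_line.
rewrite /f double_well_line -/c -/a [X in s * X]big1; last first.
  by move=> i _; rewrite -/a stat subrr mul0r.
rewrite -subr_ge0 horner_Poly /=.
by congr (0 <= _); field.
Unshelve. all: by end_near.
Qed.

(** At a stationary point the increment from [w] to [w + v] is half of [v^T A v] plus half of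
    [(dot w v + dot v v / 2) ^+ 2]. If no [a i] were negative, it would be nonnegative for every
    [v], and [w] would be global. *)
Lemma nonglobal_curv_lt0 : local_nonglobal_minimizer f w -> exists k, a k < 0.
Proof.
move=> [wmin wNglob]; apply: contrapT => a_ge0; apply: wNglob => u.
have stat := local_minimizer_stationary wmin.
rewrite -subr_ge0 -[u](subrK w) [u - w + w]addrC -[u - w]scale1r.
set v := u - w.
rewrite /f double_well_line [X in 1 * X]big1; last first.
  by move=> i _; rewrite -/a stat subrr mul0r.
have : 0 <= \sum_i a i * v i 0 ^+ 2.
  apply: sumr_ge0 => i _; apply: mulr_ge0; last exact: sqr_ge0.
  by rewrite leNgt; apply/negP => ai_lt0; apply: a_ge0; exists i.
rewrite -/a; have := sqr_ge0 (dot w v + dot v v / 2); lra.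
Qed.

End SecondOrder.

(** * Positive semidefinite [diag a + w w^T] with a negative entry [a k] *)

Section OneNegativeDirection.
Variables (R : realType) (n : nat) (a : 'I_n -> R) (w : 'cV[R]_n).
Hypothesis hess_ge0 :
  forall v : 'cV[R]_n, 0 <= \sum_i a i * v i 0 ^+ 2 + dot w v ^+ 2.
Variable k : 'I_n.
Hypothesis ak_lt0 : a k < 0.

Lemma neg_direction_neq0 : w k 0 != 0.
Proof.
have := hess_ge0 (delta_mx k 0); rewrite /dot.
rewrite (bigD1 k) //= big1 => [|i /negPf ik]; last by rewrite mxE ik /=; ring.
rewrite (bigD1 k) //= big1 => [|i /negPf ik]; last by rewrite mxE ik /=; ring.
rewrite mxE !eqxx /=; apply: contraTneq => ->; move: ak_lt0; lra.
Qed.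

(* Test vector orthogonal to [w] in the plane of coordinates [i] and [k]. *)
Lemma curv_ge0 i : i != k -> 0 <= a i /\ (a i = 0 -> w i 0 = 0).
Proof.
move=> ik; have wk0 := neg_direction_neq0; set c := w i 0 / w k 0.
have := hess_ge0 (delta_mx i 0 - c *: delta_mx k 0).
rewrite /dot.
rewrite (bigD1 i) //= (bigD1 k) /= 1?eq_sym // big1; last first.
  by move=> j /andP[/negPf ji /negPf jk]; rewrite !mxE ji jk /=; ring.
rewrite (bigD1 i) //= (bigD1 k) /= 1?eq_sym // big1; last first.
  by move=> j /andP[/negPf ji /negPf jk]; rewrite !mxE ji jk /=; ring.
rewrite !mxE !eqxx (negPf ik) eq_sym (negPf ik) /= => h.
have h' : 0 <= a i + a k * c ^+ 2.
  move: h; congr (0 <= _); rewrite /c; field; exact: wk0.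
have c2 := sqr_ge0 c.
split; first by move: ak_lt0; nra.
move=> ai0; have : c ^+ 2 = 0 by move: ak_lt0; nra.
move/eqP; rewrite sqrf_eq0 mulf_eq0 invr_eq0 (negPf wk0) orbF.
by move/eqP.
Qed.

(* For invertible [A = diag a], this is [det (A + w w^T) >= 0] divided by
   [det A < 0].  Where [a i = 0], also [w i 0 = 0] and the quotient is [0]. *)
Lemma sum_sqr_div_curv_le : \sum_i w i 0 ^+ 2 / a i <= -1.
Proof.
pose S := \sum_(i | i != k) w i 0 ^+ 2 / a i.
have S_ge0 : 0 <= S.
  by apply: sumr_ge0 => i /curv_ge0[ai _]; rewrite divr_ge0 ?sqr_ge0.
(* All entries of [(A + w w^T) v] but the [k]-th vanish, and the form at [v] equals
   [(1 + S) * (a k * (1 + S) + w k 0 ^+ 2)]. *)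
pose v : 'cV[R]_n := \col_j (if j == k then - (1 + S) else w k 0 * (w j 0 / a j)).
have avv : \sum_i a i * v i 0 ^+ 2 = a k * (1 + S) ^+ 2 + w k 0 ^+ 2 * S.
  rewrite (bigD1 k) //= mxE eqxx sqrrN; congr (_ + _).
  rewrite mulr_sumr; apply: eq_bigr => i ik; rewrite mxE (negPf ik).
  have [ai0|ai0] := eqVneq (a i) 0; first by rewrite ai0 invr0; ring.
  by field.
have wv : dot w v = - w k 0.
  rewrite /dot (bigD1 k) //= mxE eqxx.
  have -> : \sum_(i | i != k) w i 0 * v i 0 = w k 0 * S.
    by rewrite mulr_sumr; apply: eq_bigr => i ik; rewrite mxE (negPf ik); ring.
  by ring.
have := hess_ge0 v; rewrite avv wv => h.
have h' : 0 <= a k * (1 + S) + w k 0 ^+ 2 by nra.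
rewrite (bigD1 k) //= -/S -lerBrDr ler_ndivrMr //.
by move: h'; lra.
Qed.

End OneNegativeDirection.

(** With [psi = a * x = b * y], the function [psi ^+ 2 / t ^+ 2] takes the values [x ^+ 2] at [a]
    and [y ^+ 2] at [b], and its slope at [a] is [- 2 * x ^+ 2 / a]. The identity gives its excess
    over the tangent at [a], positive when [a] and [b] have the same sign and [x] and [b - a] are
    nonzero. *)
Lemma sqr_secant_curv (R : realType) (a b x y : R) : b != 0 -> a != 0 ->
  a * x = b * y ->
  y ^+ 2 - x ^+ 2 + 2 * (b - a) * (x ^+ 2 / a) =
  x ^+ 2 * (b - a) ^+ 2 * ((a + 2 * b) / a) / b ^+ 2.
Proof.
move=> b0 a0 axby; have -> : y = a * x / b by rewrite axby mulrC mulKf.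
by field; rewrite a0 b0.
Qed.

(** * Comparison of two local non-global minimizers *)

Section TwoMinimizers.
Variables (R : realType) (n : nat) (nu : R) (psi : 'cV[R]_n) (alpha : 'rV[R]_n).
Let f := double_well nu psi (diag_mx alpha).
Variables x y : 'cV[R]_n.
Hypotheses (xP : local_nonglobal_minimizer f x)
  (yP : local_nonglobal_minimizer f y).
Let a := curv nu alpha x.
Let b := curv nu alpha y.

Let curv_sub i : b i - a i = 2^-1 * (dot y y - dot x x).
Proof. by rewrite /a /b /curv; ring. Qed.

Lemma local_nonglobal_norm_le : dot y y <= dot x x.
Proof.
rewrite leNgt; apply/negP => xy; pose d := 2^-1 * (dot y y - dot x x).
have d_gt0 : 0 < d by rewrite /d; lra.
have bE i : b i = a i + d by rewrite -(subrK (a i) (b i)) curv_sub addrC.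
have [k bk_lt0] := nonglobal_curv_lt0 yP; rewrite -/b in bk_lt0.
(* Since [d > 0], the negative index of [y] is also the one of [x], so [a k] and [b k] lie on the
   same side of the pole. *)
have ak_lt0 : a k < 0 by move: bk_lt0; rewrite bE; lra.
have hess := local_minimizer_hessian_ge0 xP.1.
have stat i : a i * x i 0 = b i * y i 0.
  by rewrite (local_minimizer_stationary xP.1) (local_minimizer_stationary yP.1).
have xk0 : x k 0 != 0 := neg_direction_neq0 hess ak_lt0.
have sec i : b i != 0 -> a i != 0 ->
    y i 0 ^+ 2 - x i 0 ^+ 2 + 2 * d * (x i 0 ^+ 2 / a i)
    = x i 0 ^+ 2 * d ^+ 2 * ((a i + 2 * b i) / a i) / b i ^+ 2.
  by move=> bi ai; rewrite /d -(curv_sub i) sqr_secant_curv.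
have k_gt0 : 0 < y k 0 ^+ 2 - x k 0 ^+ 2 + 2 * d * (x k 0 ^+ 2 / a k).
  rewrite sec ?ltr0_neq0 //.
  have xk_gt0 : 0 < x k 0 ^+ 2 by rewrite exprn_even_gt0.
  have bk_gt0 : 0 < b k ^+ 2 by rewrite exprn_even_gt0 ?ltr0_neq0.
  apply: divr_gt0 => //; rewrite pmulr_rgt0; last by rewrite mulr_gt0 // exprn_gt0.
  by rewrite nmulr_rgt0 ?invr_lt0 //; lra.
have i_ge0 i : i != k -> 0 <= y i 0 ^+ 2 - x i 0 ^+ 2 + 2 * d * (x i 0 ^+ 2 / a i).
  move=> /(curv_ge0 hess ak_lt0)[]; rewrite -/a => ai_ge0 xi0.
  have bi_gt0 : 0 < b i by rewrite bE; lra.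
  (* At the pole [a i = 0] also [x i 0 = 0], and only [y i 0 ^+ 2] remains. *)
  have [ai0|ai0] := eqVneq (a i) 0.
    by rewrite xi0 // expr0n mul0r mulr0 addr0 subr0 sqr_ge0.
  rewrite sec // ?gt_eqF // divr_ge0 ?sqr_ge0 //.
  apply: mulr_ge0; first by rewrite mulr_ge0 ?sqr_ge0.
  by rewrite divr_ge0 //; lra.
have : 0 < \sum_i (y i 0 ^+ 2 - x i 0 ^+ 2 + 2 * d * (x i 0 ^+ 2 / a i)).
  by rewrite (bigD1 k) //=; apply: ltr_pwDl => //; exact: sumr_ge0.
have -> : \sum_i (y i 0 ^+ 2 - x i 0 ^+ 2 + 2 * d * (x i 0 ^+ 2 / a i))
    = 2 * d * (1 + \sum_i x i 0 ^+ 2 / a i).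
  rewrite big_split /= sumrB -mulr_sumr mulrDr; congr (_ + _).
  by rewrite /d /dot; field.
rewrite pmulr_rgt0; last by lra.
by have := sum_sqr_div_curv_le hess ak_lt0; rewrite -/a; lra.
Qed.

(** Equal norms give both points the same [A], and [A x = psi = A y] fixes the coordinates with
    [a i != 0]. The others vanish at both points by [curv_ge0]. *)
Lemma local_nonglobal_eq : dot x x = dot y y -> x = y.
Proof.
move=> xy; have [k ak_lt0] := nonglobal_curv_lt0 xP; rewrite -/a in ak_lt0.
have ab i : a i = b i by apply/esym/subr0_eq; rewrite curv_sub xy subrr mulr0.
have hessx := local_minimizer_hessian_ge0 xP.1.
have hessy := local_minimizer_hessian_ge0 yP.1.
have bk_lt0 : b k < 0 by rewrite -ab.
apply/colP => i.
have [ai0|ai0] := eqVneq (a i) 0.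
  have ik : i != k by apply: contraTneq ak_lt0 => <-; rewrite ai0 ltxx.
  have [_ -> //] := curv_ge0 hessx ak_lt0 ik.
  by have [_ -> //] := curv_ge0 hessy bk_lt0 ik; rewrite -/b -ab.
apply: (mulfI ai0); rewrite {2}ab.
by rewrite (local_minimizer_stationary xP.1) (local_minimizer_stationary yP.1).
Qed.

End TwoMinimizers.

Theorem theorem1 (R : realType) (n : nat) (n_gt0 : (0 < n)%N)
    (nu : R) (psi : 'cV[R]_n) (alpha : 'rV[R]_n)
    (alpha_le : forall i j : 'I_n, (i <= j)%N -> alpha 0 i <= alpha 0 j)
    (w1 w2 : 'cV[R]_n) :
  local_nonglobal_minimizer (double_well nu psi (diag_mx alpha)) w1 ->
  local_nonglobal_minimizer (double_well nu psi (diag_mx alpha)) w2 ->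
  w1 = w2.
Proof.
move=> w1P w2P; apply: (local_nonglobal_eq w1P w2P); apply/eqP.
by rewrite eq_le (local_nonglobal_norm_le w2P w1P) (local_nonglobal_norm_le w1P w2P).
Qed.
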